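(* Let $\mathbb{X}$ be a real Banach space and $\mathbb{Y}$ a real normed space. Let $T \in B(\mathbb{X},\mathbb{Y})$ and $x_0 \in S_{\mathbb{X}}$. Suppose that $T$ attains its norm only at $\pm x_0$, i.e. $\{x \in S_{\mathbb{X}} : \|Tx\| = \|T\|\} = \{x_0, -x_0\}$, that $Tx_0$ is a smooth point of $\mathbb{Y}$, and that $\sup\{\|Tx\| : x \in C\} < \|T\|$ for all closed subsets $C$ of $S_{\mathbb{X}}$ with $d(\pm x_0, C) > 0$. Then $T$ is a smooth point of $B(\mathbb{X},\mathbb{Y})$.
   Context: $S_{\mathbb{X}} = \{x \in \mathbb{X} : \|x\| = 1\}$. $B(\mathbb{X},\mathbb{Y})$ is the normed space of bounded linear operators from $\mathbb{X}$ to $\mathbb{Y}$ with the operator norm. $d(\pm x_0, C)$ denotes the distance between the set $\{x_0,-x_0\}$ and $C$, i.e. $\inf\{\|u-y\| : u \in \{x_0,-x_0\}, y \in C\}$. A non-zero element $u$ of a real normed space $\mathbb{Z}$ is a smooth point of $\mathbb{Z}$ if there is a unique linear functional $f \in \mathbb{Z}^*$ with $\|f\| = 1$ and $f(u) = \|u\|$. *)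

(* Defs.v *)
From HB Require Import structures.
From mathcomp Require Import all_boot all_order all_algebra.
From mathcomp Require Import all_classical all_reals all_analysis.

Set Implicit Arguments.
Unset Strict Implicit.
Unset Printing Implicit Defensive.

Import Order.TTheory GRing.Theory Num.Theory.
Import numFieldNormedType.Exports.

Local Open Scope classical_set_scope.
Local Open Scope ring_scope.

Section BoundedOperators.
Context {R : realType}.
Variables X Y : normedModType R.

Definition bounded_operator : {pred X -> Y} :=
  [pred f : X -> Y | `[< linear f /\ bounded_fun_norm f >] ].

Lemma bounded_operatorP (f : X -> Y) :
  reflect (linear f /\ exists M : R, forall x, `|f x| <= M * `|x|)
          (f \in bounded_operator).
Proof.
apply: (equivP (asboolP _)); split=> -[lf bf]; split=> //.
- have [M fM] := bf 1; exists M => x.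
  pose g : {linear X -> Y} := HB.pack f (GRing.isLinear.Build _ _ _ _ _ lf).
  have [->|x0] := eqVneq x 0.
    by rewrite normr0 mulr0 (_ : f 0 = 0) ?normr0//; exact: (linear0 g).
  have nx0 : 0 < `|x| by rewrite normr_gt0.
  have := fM (`|x|^-1 *: x); rewrite (_ : f _ = `|x|^-1 *: f x); last first.
    exact: (linearZZ g).
  rewrite !normrZ normfV normr_id mulVf ?gt_eqF// => /(_ (lexx _)).
  by rewrite mulrC ler_pdivrMr.
- move=> r; have [M fM] := bf; exists (`|M| * r) => x xr.
  apply: (le_trans (fM x)); apply: (@le_trans _ _ (`|M| * `|x|)).
    by rewrite ler_wpM2r// ler_norm.
  by rewrite ler_wpM2l.
Qed.

Fact bounded_operator_submod_closed : submod_closed bounded_operator.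
Proof.
split=> [|a f g /bounded_operatorP[lf [M fM]] /bounded_operatorP[lg [N gN]]].
  apply/bounded_operatorP; split; first by move=> k x y; rewrite scaler0 addr0.
  by exists 0 => x; rewrite mul0r normr0.
apply/bounded_operatorP; split.
  move=> k x y; change (a *: f (k *: x + y) + g (k *: x + y) =
    k *: (a *: f x + g x) + (a *: f y + g y)).
  by rewrite lf lg !scalerDr !scalerA (mulrC a k) addrACA.
exists (`|a| * M + N) => x; change (`|a *: f x + g x| <= (`|a| * M + N) * `|x|).
rewrite (le_trans (ler_normD _ _))// normrZ mulrDl lerD// -mulrA.
by rewrite ler_wpM2l.
Qed.

HB.instance Definition _ :=
  GRing.isSubmodClosed.Build R (X -> Y) bounded_operator
    bounded_operator_submod_closed.

Record bop := Bop {
  bop_fun :> X -> Y;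
  bop_funP : bop_fun \in bounded_operator
}.

HB.instance Definition _ := [isSub for bop_fun].
HB.instance Definition _ := [Choice of bop by <:].
HB.instance Definition _ := [SubChoice_isSubLmodule of bop by <:].

Lemma bop_linear (T : bop) : linear T.
Proof. by have /bounded_operatorP[] := bop_funP T. Qed.

HB.instance Definition _ (T : bop) :=
  GRing.isLinear.Build R X Y *:%R (bop_fun T) (bop_linear T).

Lemma bopP (S T : bop) : (forall x, S x = T x) -> S = T.
Proof. by move=> ST; apply: val_inj; apply/funext. Qed.

Lemma bopDE (S T : bop) x : (S + T) x = S x + T x. Proof. by []. Qed.

Lemma bopZE (a : R) (T : bop) x : (a *: T) x = a *: T x. Proof. by []. Qed.

Definition opnorm (T : bop) : R := sup [set `|T x| | x in [set x | `|x| <= 1]].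

Fact opnorm_has_sup (T : bop) :
  has_sup [set `|T x| | x in [set x | `|x| <= 1]].
Proof.
split; first by exists `|T 0|, 0 => //=; rewrite normr0.
have /bounded_operatorP[_ [M TM]] := bop_funP T.
exists `|M| => _ /= [x x1 <-]; apply: (le_trans (TM x)).
rewrite (le_trans (ler_norm _))// normrM normr_id -[leRHS]mulr1.
by rewrite ler_wpM2l.
Qed.

Lemma ler_opnorm (T : bop) (x : X) : `|T x| <= opnorm T * `|x|.
Proof.
have [->|x0] := eqVneq x 0; first by rewrite linear0 !normr0 mulr0.
have nx0 : 0 < `|x| by rewrite normr_gt0.
rewrite -ler_pdivrMr//.
have -> : `|T x| / `|x| = `|T (`|x|^-1 *: x)|.
  by rewrite linearZZ normrZ normfV normr_id mulrC.
apply: sup_upper_bound; first exact: opnorm_has_sup.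
by exists (`|x|^-1 *: x) => //=; rewrite normrZ normfV normr_id mulVf ?gt_eqF.
Qed.

Lemma opnorm_ler (T : bop) (M : R) :
  (forall x, `|x| <= 1 -> `|T x| <= M) -> opnorm T <= M.
Proof.
move=> TM; apply: ge_sup; first by case: (opnorm_has_sup T).
by move=> _ /= [x x1 <-]; exact: TM.
Qed.

Fact opnorm_ge0 (T : bop) : 0 <= opnorm T.
Proof.
have -> : 0 = `|T 0| by rewrite linear0 normr0.
apply: sup_upper_bound; first exact: opnorm_has_sup.
by exists 0 => //=; rewrite normr0.
Qed.

Fact opnormD (S T : bop) : opnorm (S + T) <= opnorm S + opnorm T.
Proof.
apply: opnorm_ler => x x1; rewrite bopDE (le_trans (ler_normD _ _))//.
apply: lerD; apply: (le_trans (ler_opnorm _ _)).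
  by rewrite -[leRHS]mulr1 ler_wpM2l ?opnorm_ge0.
by rewrite -[leRHS]mulr1 ler_wpM2l ?opnorm_ge0.
Qed.

Fact opnormZ_le (a : R) (T : bop) : opnorm (a *: T) <= `|a| * opnorm T.
Proof.
apply: opnorm_ler => x x1; rewrite bopZE normrZ ler_wpM2l//.
by rewrite (le_trans (ler_opnorm _ _))// -[leRHS]mulr1 ler_wpM2l ?opnorm_ge0.
Qed.

Fact opnormZ (a : R) (T : bop) : opnorm (a *: T) = `|a| * opnorm T.
Proof.
apply/eqP; rewrite eq_le opnormZ_le/=.
have [->|a0] := eqVneq a 0; first by rewrite normr0 mul0r opnorm_ge0.
rewrite -ler_pdivlMl ?normr_gt0// -normfV.
by rewrite -[X in opnorm X <= _](scalerK a0) opnormZ_le.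
Qed.

Fact opnorm0_eq0 (T : bop) : opnorm T = 0 -> T = 0.
Proof.
move=> T0; apply: bopP => x; apply/eqP; rewrite -normr_le0.
by have := ler_opnorm T x; rewrite T0 mul0r.
Qed.

HB.instance Definition _ :=
  Lmodule_isNormed.Build R bop opnormD opnormZ opnorm0_eq0.

Lemma bop_normE (T : bop) :
  `|T| = sup [set `|T x| | x in [set x | `|x| <= 1]].
Proof. by []. Qed.

End BoundedOperators.

Section Notions.
Context {R : realType}.

(* The dual of Z is the space of bounded operators from Z to the scalars R^o,
   so that |f| below is the dual norm. *)
Definition smooth_point (Z : normedModType R) (u : Z) : Prop :=
  u != 0 /\ exists! f : bop Z R^o, `|f| = 1 /\ f u = `|u|.

Definition unit_sphere (X : normedModType R) : set X := [set x | `|x| = 1].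

(* Extended-real infimum, so that the distance to the empty set is +oo. *)
Definition set_dist (X : normedModType R) (A B : set X) : \bar R :=
  ereal_inf [set (`|u - y|)%:E | u in A & y in B].

End Notions.

Arguments unit_sphere {R} X.

(* Main.v *)
(** For a smooth point [u] and [g] its supporting functional, the norm has
    derivative [g v] at [u] in every direction [v]; substituting [t = 1/s] in
    the difference quotient, [inf_(t >= 0) (|v + t u| - t |u|) = g v].  This
    uses Hahn-Banach, obtained here from Zorn's lemma applied to sublinear
    functionals ordered pointwise: the minimal ones are linear.

    The functional [A |-> g (A x0)] supports [T].  If [F] is another one, then
    [F A <= |A + t T| - t |T|] for all [t >= 0].  For large [t] the right-hand
    side is at most [g (A x0) + e]: near [x0] and [- x0] this follows from the
    directional derivative at [T x0], and on the rest of the sphere [|T x|]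
    stays away from [|T|].  Applied to [A] and [- A], this gives
    [F A = g (A x0)]. *)
From HB Require Import structures.
Require Import Defs.
From mathcomp Require Import all_boot all_order all_algebra.
From mathcomp Require Import all_classical all_reals all_analysis.
From mathcomp Require Import lra.

Import Order.TTheory GRing.Theory Num.Theory.
Import numFieldNormedType.Exports.

Local Open Scope classical_set_scope.
Local Open Scope ring_scope.

(** * Sublinear functionals and the Hahn-Banach theorem *)

Section Sublinear.
Set Implicit Arguments.
Unset Strict Implicit.
Context {R : realType} {V : lmodType R}.
Implicit Types (p q : V -> R) (x y v : V).

(** An inequality for [c > 0] is convenient to check on infima; applied to [c^-1] as well it yields
    equality. *)
Definition sublinear p :=
  (forall x y, p (x + y) <= p x + p y) /\
  (forall c x, 0 < c -> p (c *: x) <= c * p x).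

Lemma sublinear0 p : sublinear p -> p 0 = 0.
Proof.
move=> [pD pZ]; have := pD 0 0; have := pZ 2^-1 0.
by rewrite addr0 scaler0 => /(_ ltac:(lra)); lra.
Qed.

Lemma sublinearN_ge p x : sublinear p -> - p (- x) <= p x.
Proof. by move=> sp; have := sp.1 x (- x); rewrite subrr sublinear0//; lra. Qed.

Lemma sublinearZ p c x : sublinear p -> 0 <= c -> p (c *: x) = c * p x.
Proof.
move=> sp; rewrite le_eqVlt => /predU1P[<-|c0].
  by rewrite scale0r mul0r sublinear0.
apply/eqP; rewrite eq_le sp.2//= -ler_pdivlMl//.
by rewrite -{1}[x](scalerK (lt0r_neq0 c0)) sp.2// invr_gt0.
Qed.

Lemma additive_sublinear_linear p :
  sublinear p -> (forall x y, p (x + y) = p x + p y) ->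
  linear (p : V -> R^o).
Proof.
move=> sp pD c x y; rewrite pD; congr (_ + _).
have pN z : p (- z) = - p z.
  by have := pD z (- z); rewrite subrr sublinear0//; lra.
have [c0|c0] := leP 0 c; first exact: sublinearZ.
rewrite -{1}[c]opprK scaleNr pN sublinearZ ?oppr_ge0 ?ltW//.
by rewrite mulNr opprK.
Qed.

(** Letting the index [k] vary covers both uses: for tilts the parameters add and scale, and in a
    chain the smaller of two functionals serves. *)
Lemma inf_sublinear (I : Type) (D : set I) (q : I -> V -> R) :
  D !=set0 ->
  (forall x, exists m, forall i, D i -> m <= q i x) ->
  (forall i j x y, D i -> D j ->
     exists2 k, D k & q k (x + y) <= q i x + q j y) ->
  (forall i c x, D i -> 0 < c -> exists2 k, D k & q k (c *: x) <= c * q i x) ->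
  sublinear (fun x => inf [set q i x | i in D]).
Proof.
move=> [i0 Di0] qlb qD qZ.
have hinf x : has_inf [set q i x | i in D].
  split; first by exists (q i0 x), i0.
  by have [m mq] := qlb x; exists m => _ [i Di <-]; exact: mq.
have infle i x : D i -> inf [set q i x | i in D] <= q i x.
  by move=> Di; apply: ge_inf; [case: (hinf x)|exists i].
split=> [x y|c x c0] /=.
  rewrite -lerBlDr.
  apply: lb_le_inf; first by case: (hinf x).
  move=> _ [i Di <-]; rewrite lerBlDr -lerBlDl.
  apply: lb_le_inf; first by case: (hinf y).
  move=> _ [j Dj <-]; rewrite lerBlDl.
  by have [k Dk] := qD i j x y Di Dj; apply: le_trans; exact: infle.
rewrite mulrC -ler_pdivrMr//; apply: lb_le_inf; first by case: (hinf x).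
move=> _ [i Di <-]; rewrite ler_pdivrMr// mulrC.
by have [k Dk] := qZ i c x Di c0; apply: le_trans; exact: infle.
Qed.

(* For [p] a norm, [tilt p x y] is the one-sided derivative of [p] at [x] in the
   direction [y], with [t] the inverse of the step. *)
Definition tilt p x y : R :=
  inf [set p (y + t *: x) - t * p x | t in [set t : R | 0 <= t]].

Lemma tilt_lbound p x y t : sublinear p -> 0 <= t ->
  - p (- y) <= p (y + t *: x) - t * p x.
Proof.
move=> sp t0; rewrite -sublinearZ//.
by have := sp.1 (y + t *: x) (- y); rewrite addrAC subrr add0r; lra.
Qed.

Lemma tilt_has_inf p x y : sublinear p ->
  has_inf [set p (y + t *: x) - t * p x | t in [set t : R | 0 <= t]].
Proof.
move=> sp; split; first by exists (p (y + 0 *: x) - 0 * p x), 0 => /=.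
by exists (- p (- y)) => _ [t t0 <-]; exact: tilt_lbound.
Qed.

Lemma tilt_le p x y t : sublinear p -> 0 <= t ->
  tilt p x y <= p (y + t *: x) - t * p x.
Proof.
by move=> sp t0; apply: ge_inf; [case: (tilt_has_inf x y sp)|exists t].
Qed.

Lemma tilt_sublinear p x : sublinear p -> sublinear (tilt p x).
Proof.
move=> sp; apply: inf_sublinear => [|y|s t y z s0 t0|t c y t0 c0].
- by exists 0 => /=.
- by exists (- p (- y)) => t; exact: tilt_lbound.
- exists (s + t); first exact: addr_ge0.
  have := sp.1 (y + s *: x) (z + t *: x).
  by rewrite addrACA -scalerDl; lra.
- exists (c * t); first by rewrite /= mulr_ge0// ltW.
  by rewrite -scalerA -scalerDr sublinearZ// ?(ltW c0)//; lra.
Qed.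

Lemma tilt_le_self p x y : sublinear p -> tilt p x y <= p y.
Proof.
by move=> sp; have := tilt_le x y sp (lexx 0); rewrite scale0r addr0; lra.
Qed.

Lemma tiltN_le p x : sublinear p -> tilt p x (- x) <= - p x.
Proof.
move=> sp; have := tilt_le x (- x) sp ler01.
by rewrite scale1r addNr sublinear0//; lra.
Qed.

(** A chain is bounded below by its pointwise infimum, which is finite because every sublinear [q]
    under [p] satisfies [q x >= - q (- x) >= - p (- x)]. *)
Lemma minimal_sublinear p : sublinear p ->
  exists q, [/\ sublinear q, (forall x, q x <= p x) &
    forall r, sublinear r -> (forall x, r x <= q x) -> r = q].
Proof.
move=> sp; pose P q := sublinear q /\ forall x, q x <= p x.
pose T := {q : V -> R | P q}.
(* The order is reversed, so that Zorn's maximal elements are minimal functionals. *)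
pose below (q r : T) := `[< forall x, sval r x <= sval q x >].
have [|q r s /asboolP qr /asboolP rs|q r /asboolP qr /asboolP rq|A Atot|q qmin]
  := @Zorn T below.
- by move=> q; apply/asboolP.
- by apply/asboolP => x; exact: le_trans (rs x) (qr x).
- move: q r qr rq => [q qP] [r rP] /= qr rq; apply: eq_exist.
  by apply/funext => x; apply/eqP; rewrite eq_le qr rq.
- have [[q0 Aq0]|/set0P/negP/negPn/eqP A0] := pselect (A !=set0); last first.
    exists (exist P p (conj sp (fun x => lexx (p x))) : T) => s.
    by rewrite A0.
  have lb (q : T) x : - p (- x) <= sval q x.
    have [sq qp] := svalP q; apply: le_trans (sublinearN_ge x sq).
    by rewrite lerN2.
  have sinf : sublinear (fun x => inf [set sval q x | q in A]).
    apply: inf_sublinear => [|x|q r x y Aq Ar|q c x Aq c0].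
    + by exists q0.
    + by exists (- p (- x)) => q _.
    + have [/asboolP qr|/asboolP rq] := Atot q r Aq Ar.
        by exists r => //; have := (svalP r).1.1 x y; have := qr x; lra.
      by exists q => //; have := (svalP q).1.1 x y; have := rq y; lra.
    + by exists q => //; exact: (svalP q).1.2.
  have infle (q : T) x : A q -> inf [set sval q x | q in A] <= sval q x.
    move=> Aq; apply: ge_inf; last by exists q.
    by exists (- p (- x)) => _ [r _ <-].
  have infp x : inf [set sval q x | q in A] <= p x.
    by apply: le_trans (infle q0 x Aq0) _; exact: (svalP q0).2.
  exists (exist P _ (conj sinf infp) : T) => q Aq.
  by apply/asboolP => x; exact: infle.
- have [sq qp] := svalP q; exists (sval q); split=> // r sr rq.
  have rp x : r x <= p x by exact: le_trans (rq x) (qp x).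
  have := qmin (exist P r (conj sr rp) : T).
  by move=> <- //; apply/asboolP.
Qed.

(* A minimal sublinear functional equals all its tilts, hence is additive. *)
Lemma sublinear_ge_linear p : sublinear p ->
  exists f : {linear V -> R^o}, forall x, f x <= p x.
Proof.
move=> /minimal_sublinear[q [sq qp qmin]].
have qD x y : q (x + y) = q x + q y.
  apply/eqP; rewrite eq_le sq.1/=.
  have tq : tilt q x = q.
    by apply: qmin => [|z]; [exact: tilt_sublinear|exact: tilt_le_self].
  (* At [t = 1] this reads [q y <= q (y + x) - q x], the converse of subadditivity. *)
  have := tilt_le x y sq ler01.
  by rewrite tq scale1r [y + x]addrC; lra.
pose f : {linear V -> R^o} :=
  HB.pack (q : V -> R^o)
    (GRing.isLinear.Build _ _ _ _ _ (additive_sublinear_linear sq qD)).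
by exists f.
Qed.

(** Tilt at [x], then at [v], and take a linear [f] below the result. Each tilt bounds [f] from
    above at [- x] or [- v], hence from below at [x] or [v]. *)
Lemma tilt_linear p x v : sublinear p ->
  exists f : {linear V -> R^o},
    [/\ forall y, f y <= p y, f x = p x & f v = tilt p x v].
Proof.
move=> sp; have st := tilt_sublinear x sp.
have [f ft] := sublinear_ge_linear (tilt_sublinear v st).
have ftx y : f y <= tilt p x y by apply: le_trans (ft y) (tilt_le_self v y st).
have fp y : f y <= p y by apply: le_trans (ftx y) (tilt_le_self x y sp).
exists f; split=> //; apply/eqP; rewrite eq_le ?fp ?ftx/=.
  by rewrite -lerN2 -linearN; apply: le_trans (ftx _) (tiltN_le x sp).
by rewrite -lerN2 -linearN; apply: le_trans (ft _) (tiltN_le v st).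
Qed.

End Sublinear.

Lemma norm_sublinear {R : realType} (Z : normedModType R) :
  sublinear (fun z : Z => `|z|).
Proof.
split=> [x y|c x c0]; first exact: ler_normD.
by rewrite normrZ gtr0_norm.
Qed.

(** * Supporting functionals and smoothness *)

Section Support.
Set Implicit Arguments.
Unset Strict Implicit.
Context {R : realType}.

Lemma bop_norm1_le (Z : normedModType R) (h : bop Z R^o) z :
  `|h| = 1 -> h z <= `|z|.
Proof.
move=> h1; have := ler_opnorm h z; rewrite (_ : opnorm h = 1)// mul1r.
exact: le_trans (ler_norm _).
Qed.

(** Replacing [z] by [- z] makes the bound two-sided, so the norm is at most 1; the value at [u]
    shows that it is at least 1. *)
Lemma support_bop (Z : normedModType R) (u : Z) (f : {linear Z -> R^o}) :
  u != 0 -> (forall z, f z <= `|z|) -> f u = `|u| ->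
  exists h : bop Z R^o, (forall z, h z = f z) /\ `|h| = 1.
Proof.
move=> u0 fle fu.
have fabs z : `|f z| <= `|z|.
  by rewrite ler_norml fle andbT -lerN2 opprK -linearN -(normrN z) fle.
have fb : (f : Z -> R^o) \in @bounded_operator R Z R^o.
  apply/bounded_operatorP; split; first exact: linearP.
  by exists 1 => z; rewrite mul1r.
exists (Bop fb); split=> //; apply/eqP; rewrite eq_le; apply/andP; split.
  by apply: opnorm_ler => z z1; apply: le_trans (fabs z) z1.
have := ler_opnorm (Bop fb) u; rewrite /= fu normr_id.
by rewrite -{1}[`|u|]mul1r ler_pM2r ?normr_gt0.
Qed.

(* Each one-sided directional derivative of the norm at [u] is attained by
   some supporting functional, and smoothness leaves only [g]. *)
Lemma smooth_tilt (Z : normedModType R) (u v : Z) (g : bop Z R^o) :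
  smooth_point u -> `|g| = 1 -> g u = `|u| ->
  tilt (fun z : Z => `|z|) u v = g v.
Proof.
move=> [u0 [g' [_ guniq]]] g1 gu.
have [f [fle fu <-]] := tilt_linear u v (norm_sublinear Z).
have [h [hf h1]] := support_bop u0 fle fu.
by rewrite -hf -(guniq h) ?hf// (guniq g).
Qed.

Lemma tilt_norm_lt (Z : normedModType R) (u v : Z) a :
  tilt (fun z : Z => `|z|) u v < a ->
  exists2 t, 0 <= t & `|v + t *: u| < t * `|u| + a.
Proof.
have [+ _] := tilt_has_inf u v (norm_sublinear Z).
move=> /inf_lt h /h[_ [t t0 <-]]; rewrite ltrBlDl => tlt.
by exists t.
Qed.

End Support.

(** * Estimates on the unit sphere, near and away from the antipodes *)

Section OperatorNorm.
Set Implicit Arguments.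
Unset Strict Implicit.
Context {R : realType} {X Y : normedModType R}.

Lemma opnorm_sphere_ler (S : bop X Y) M : 0 <= M ->
  (forall x, `|x| = 1 -> `|S x| <= M) -> `|S| <= M.
Proof.
move=> M0 SM; apply: opnorm_ler => x x1.
have [->|x0] := eqVneq x 0; first by rewrite linear0 normr0.
have nx0 : 0 < `|x| by rewrite normr_gt0.
have /SM : `|(`|x|^-1 *: x)| = 1.
  by rewrite normrZ normfV normr_id mulVf// gt_eqF.
rewrite linearZZ normrZ normfV normr_id mulrC ler_pdivrMr// => /le_trans; apply.
by rewrite ler_piMr.
Qed.

Lemma near_antipodes_ler (S : bop X Y) (x0 : X) M : `|S x0| < M ->
  exists2 d : R, 0 < d & forall x,
    `|x - x0| < d \/ `|x + x0| < d -> `|S x| <= M.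
Proof.
move=> Sx0; have N0 : 0 < opnorm S + 1 by have := opnorm_ge0 S; lra.
(* [S] is Lipschitz with constant [opnorm S]; adding 1 keeps the denominator positive when
   [S = 0]. *)
exists ((M - `|S x0|) / (opnorm S + 1)); first by rewrite divr_gt0// subr_gt0.
have near x : `|x - x0| < (M - `|S x0|) / (opnorm S + 1) -> `|S x| <= M.
  rewrite ltr_pdivlMr// => xd.
  have := ler_opnorm S (x - x0); rewrite linearB.
  by have := lerB_dist (S x) (S x0); have := normr_ge0 (x - x0); lra.
move=> x [/near//|xd]; rewrite -normrN -linearN near//.
by rewrite -opprD normrN.
Qed.

Lemma sphere_minus_balls_bound (T : bop X Y) (x0 : X) (d : R) : 0 < d ->
  (forall C : set X, closed C -> C `<=` unit_sphere X ->
    (0 < set_dist [set x0; - x0]%R C)%E ->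
    (ereal_sup [set (`|T x|)%:E | x in C] < (`|T|)%:E)%E) ->
  exists2 m, m < `|T| &
    forall x, `|x| = 1 -> d <= `|x - x0| -> d <= `|x + x0| -> `|T x| <= m.
Proof.
move=> d0 sep.
pose C := [set x | `|x| = 1] `&`
  ([set x | d <= `|x - x0|] `&` [set x | d <= `|x + x0|]).
have distC : (0 < set_dist [set x0; - x0]%R C)%E.
  apply: (@lt_le_trans _ _ d%:E); first by rewrite lte_fin.
  apply: le_ereal_inf_tmp => _ [u uE [y [_ [yx0 yNx0]] <-]]; rewrite lee_fin.
  case: uE => ->; first by rewrite distrC.
  by rewrite -opprD normrN addrC.
have closedC : closed C.
  have cnorm (z : X) : continuous (fun x : X => `|x + z|).
    move=> x; apply: cvg_norm; apply: cvgD; [exact: cvg_id|exact: cvg_cst].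
  apply: closedI; last apply: closedI.
  - apply: (@closed_comp _ _ (fun x : X => `|x|) [set r : R | r = 1]).
      by move=> x _; exact: norm_continuous.
    exact: closed_eq.
  - apply: (@closed_comp _ _ (fun x : X => `|x - x0|) [set r : R | d <= r]).
      by move=> x _; exact: cnorm.
    exact: closed_ge.
  - apply: (@closed_comp _ _ (fun x : X => `|x + x0|) [set r : R | d <= r]).
      by move=> x _; exact: cnorm.
    exact: closed_ge.
have := sep C closedC (@subIsetl _ _ _) distC.
have supC x : C x -> (`|T x|%:E <= ereal_sup [set (`|T x|)%:E | x in C])%E.
  by move=> Cx; apply: ereal_sup_ubound; exists x.
case: (ereal_sup _) supC => [m| |] supC //= supT.
  by exists m => // x x1 xx0 xNx0; rewrite -lee_fin; apply: supC.
(* Here the supremum is [-oo], so [C] is empty and any number below the norm of [T] will do. *)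
exists (`|T| - 1) => [|x x1 xx0 xNx0]; first by lra.
by have := supC x (conj x1 (conj xx0 xNx0)).
Qed.

End OperatorNorm.

Theorem theorem4p3 (R : realType) (X : completeNormedModType R)
    (Y : normedModType R) (T : bop X Y) (x0 : X) :
  unit_sphere X x0 ->
  [set x | unit_sphere X x /\ `|T x| = `|T|] = [set x0; - x0] ->
  smooth_point (T x0) ->
  (forall C : set X, closed C -> C `<=` unit_sphere X ->
    (0 < set_dist [set x0; - x0]%R C)%E ->
    (ereal_sup [set (`|T x|)%:E | x in C] < (`|T|)%:E)%E) ->
  smooth_point T.
Proof.
move=> x01 Tmax sm sep.
have Tx0 : `|T x0| = `|T|.
  have : [set x0; - x0] x0 by left.
  by rewrite -Tmax => -[].
have [Tx0_neq0 [g [[g1 gTx0] _]]] := sm.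
have T0 : T != 0 by rewrite -normr_gt0 -Tx0 normr_gt0.
have opx (A : bop X Y) x : `|x| = 1 -> `|A x| <= `|A|.
  by move=> x1; have := ler_opnorm A x; rewrite x1 mulr1.
have evl : linear (fun A : bop X Y => g (A x0) : R^o).
  by move=> c A B; rewrite bopDE bopZE linearP.
pose ev : {linear bop X Y -> R^o} :=
  HB.pack (fun A : bop X Y => g (A x0) : R^o)
    (GRing.isLinear.Build _ _ _ _ _ evl).
have ev_le A : ev A <= `|A|.
  by apply: le_trans (bop_norm1_le (A x0) g1) (opx _ _ x01).
have evT : ev T = `|T| by rewrite /= gTx0.
have [h [hev h1]] := support_bop T0 ev_le evT.
split=> //; exists h; split; first by rewrite hev.
move=> F [F1 FT].
suff Fle A : F A <= g (A x0).
  apply: bopP => A; rewrite hev /=; apply/eqP; rewrite eq_le Fle andbT.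
  by have := Fle (- A); rewrite linearN (_ : (- A) x0 = - A x0)// linearN lerN2.
apply/ler_addgt0Pr => e e0; set a := g (A x0) + e.
have [|t0 t0_ge0] := @tilt_norm_lt _ _ (T x0) (A x0) a.
  by rewrite (smooth_tilt (A x0) sm g1 gTx0) ltrDl.
rewrite Tx0 -bopZE -bopDE => /near_antipodes_ler[d d0 near].
have [m mT far] := sphere_minus_balls_bound d0 sep.
(* The first bound lets the estimate at [t0] carry over to [t] near the antipodes; the second gives
   [|A| + t * m <= t * |T| + a], which settles the rest of the sphere. *)
pose t := Num.max t0 ((`|A| - a) / (`|T| - m)).
have tt0 : t0 <= t by rewrite le_max lexx.
have tA : `|A| - a <= t * (`|T| - m).
  by rewrite -ler_pdivrMr ?subr_gt0// le_max lexx orbT.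
have bound x : `|x| = 1 -> `|(A + t *: T) x| <= t * `|T| + a.
  move=> x1; rewrite bopDE bopZE.
  have [xd|/not_orP[/negP xx0 /negP xNx0]] :=
    pselect (`|x - x0| < d \/ `|x + x0| < d).
    (* The extra term [(t - t0) *: T x] adds at most [(t - t0) * |T|]. *)
    have -> : A x + t *: T x = (A + t0 *: T) x + (t - t0) *: T x.
      by rewrite bopDE bopZE -addrA -scalerDl [t0 + _]addrC subrK.
    apply: le_trans (ler_normD _ _) _.
    rewrite normrZ ger0_norm ?subr_ge0//.
    have := near x xd; have := opx T x x1.
    rewrite -subr_ge0 => /(mulr_ge0 _); move: (tt0); rewrite -subr_ge0.
    by move=> tt /(_ _ tt); lra.
  apply: le_trans (ler_normD _ _) _; rewrite normrZ ger0_norm; last first.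
    exact: le_trans tt0.
  have := far x x1; rewrite !leNgt xx0 xNx0 => /(_ isT isT).
  rewrite -leNgt -subr_ge0 => /(mulr_ge0 (le_trans t0_ge0 tt0)).
  by have := opx A x x1; lra.
have AtT : `|A + t *: T| <= t * `|T| + a.
  (* The right-hand side is nonnegative because it bounds a norm at [x0]. *)
  by apply: opnorm_sphere_ler => //; apply: le_trans (bound _ x01).
have := le_trans (bop_norm1_le (A + t *: T) F1) AtT.
have -> : F (A + t *: T) = t * `|T| + F A.
  by rewrite [A + _]addrC (bop_linear F) FT.
by rewrite lerD2l.
Qed.
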